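(* Let $N\geq 1$, $q=2^N$, let $\pi$ be a permutation of $\{0,1,\ldots,q-1\}$, and let $(I,F_\pi,\lambda)$ be the rotated odometer $F_\pi=\mathfrak{a}\circ R_\pi$ on $I=[0,1)$ with Lebesgue measure $\lambda$. Then there exists an automorphism $\widetilde F_\pi\in Aut(T_N)$ of the grafted binary tree $T_N$ and a measurable isomorphism $$\phi:(I,F_\pi,\lambda)\to(\partial T_N,\widetilde F_\pi,\mu_N)$$ such that $\widetilde F_\pi\circ\phi=\phi\circ F_\pi$, where $\widetilde F_\pi$ also denotes the homeomorphism of $\partial T_N$ induced by the automorphism.
   Context: The von Neumann–Kakutani map $\mathfrak{a}:[0,1)\to[0,1)$ is $\mathfrak{a}(x)=x-(1-3\cdot 2^{-n})$ if $x\in[1-2^{1-n},1-2^{-n})$, $n\geq1$. For $q\in\mathbb{N}$ divide $I=[0,1)$ into the $q$ half-open intervals $[k/q,(k+1)/q)$, $0\le k<q$; for a permutation $\pi$ of $q$ symbols, $R_\pi:I\to I$ is the interval exchange translating $[k/q,(k+1)/q)$ onto $[\pi(k)/q,(\pi(k)+1)/q)$. The rotated odometer is $F_\pi=\mathfrak{a}\circ R_\pi$. The grafted binary tree $T_N$ has vertex set $V=\bigsqcup_{i\ge0}V_i$ with $|V_0|=1$ (the root), $|V_1|=2^N$, $|V_i|=2^{N+i-1}$ for $i\ge2$; the root is joined by edges to all $2^N$ vertices of $V_1$, and for $i\ge1$ each vertex of $V_i$ is joined to exactly two vertices of $V_{i+1}$ and exactly one of $V_{i-1}$. Vertices of $V_1$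 are labelled by $\{0,\ldots,2^N-1\}$, and the two children of the vertex $w_1\cdots w_i$ are $w_1\cdots w_i0$ and $w_1\cdots w_i1$. The boundary is $\partial T_N=\{0,\ldots,2^N-1\}\times\prod_{i\ge2}\{0,1\}$ (infinite paths from the root), with product topology (a Cantor set). An automorphism of $T_N$ is a bijection of vertices (and edges) preserving adjacency (hence levels); $Aut(T_N)$ is the group of these, and each induces a homeomorphism of $\partial T_N$. The Bernoulli measure $\mu_N$ on $\partial T_N$ gives each cylinder $[w_1\cdots w_i]$ (paths beginning with $w_1\cdots w_i$) mass $2^{-N-i+1}$. *)

(* Defs.v *)
From HB Require Import structures.
From mathcomp Require Import all_boot all_order all_algebra all_fingroup.
From mathcomp Require Import all_classical all_reals all_analysis.
Set Implicit Arguments. Unset Strict Implicit. Unset Printing Implicit Defensive.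
Import Order.TTheory GRing.Theory Num.Theory.
Local Open Scope classical_set_scope.
Local Open Scope ring_scope.

Definition vNK_index {R : realType} (x : R) : nat :=
  xget 1%N [set n : nat | (1 <= n)%N /\
     1 - (2 : R) ^- n.-1 <= x /\ x < 1 - (2 : R) ^- n].

Definition vNK {R : realType} (x : R) : R :=
  x - (1 - 3 * (2 : R) ^- (vNK_index x)).

(* interval exchange R_pi : [k/q,(k+1)/q) -> [pi(k)/q, (pi(k)+1)/q) by translation *)
Definition iet {R : realType} (q : nat) (pi : {perm 'I_q}) (x : R) : R :=
  x + \sum_(k : 'I_q | (k%:R / q%:R <= x) && (x < k.+1%:R / q%:R))
        ((pi k)%:R - k%:R) / q%:R.

Definition rot_odometer {R : realType} (N : nat) (pi : {perm 'I_(2 ^ N)}) (x : R) : R :=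
  vNK (iet pi x).

(* vertices: None = root; Some (w1, [:: w2; ...; wi]) = vertex w1 w2 ... wi of V_i *)
Definition vertex (N : nat) := option ('I_(2 ^ N) * seq bool).

Definition vchild (N : nat) (u v : vertex N) : bool :=
  match u, v with
  | None, Some (_, t) => t == [::]
  | Some (a, s), Some (b, t) =>
      (a == b) && (size t == (size s).+1) && (take (size s) t == s)
  | _, _ => false
  end.

Definition tadj (N : nat) (u v : vertex N) : bool := vchild u v || vchild v u.

Definition tree_aut (N : nat) (g : vertex N -> vertex N) : Prop :=
  bijective g /\ forall u v, tadj (g u) (g v) = tadj u v.

(* boundary dT_N = {0..2^N-1} x prod_{i>=2} {0,1};  xi = (w1, i |-> w_(i+2)) *)
Definition boundary (N : nat) := ('I_(2 ^ N) * (nat -> bool))%type.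

Lemma boundary_default_proof (N : nat) : (0 < 2 ^ N)%N.
Proof. by rewrite expn_gt0. Qed.

HB.instance Definition _ N := Choice.on (boundary N).
HB.instance Definition _ N := isPointed.Build (boundary N)
  (Ordinal (boundary_default_proof N), fun _ => false).

Definition bprefix (N : nat) (i : nat) (xi : boundary N) : vertex N :=
  match i with
  | 0 => None
  | i'.+1 => Some (xi.1, mkseq xi.2 i')
  end.

Definition induced_by (N : nat) (g : vertex N -> vertex N)
  (G : boundary N -> boundary N) : Prop :=
  forall xi i, bprefix i (G xi) = g (bprefix i xi).

Definition cylinder (N : nat) (a : 'I_(2 ^ N)) (s : seq bool) : set (boundary N) :=
  [set xi | bprefix (size s).+1 xi = Some (a, s)].

Definition cylinders (N : nat) : set (set (boundary N)) :=
  [set C | exists a s, C = cylinder a s].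

(* dT_N with the sigma-algebra generated by cylinders (= its Borel sigma-algebra) *)
Definition bmeas (N : nat) := g_sigma_algebraType (@cylinders N).

Definition is_bernoulli_mu (R : realType) (N : nat)
  (mu : {measure set (bmeas N) -> \bar R}) : Prop :=
  forall a s, mu (cylinder a s) = ((2 : R) ^- (N + size s))%:E.

(* Main.v *)
(** Let [phi] be the binary expansion of [x], the first [N] digits being grouped
    in one letter.  The map [a] is addition of 1 with carry to the right, and
    [R_pi] permutes the first [N] digits, so for [m >= N] the level-[m] dyadic
    interval containing [F_pi x] is an injective function of the one containing
    [x].  Hence [F_pi] acts on the vertices of [T_N], injectively on each
    (finite) level and compatibly with prefixes, which is the automorphism; the
    conjugacy then holds at every point of [0, 1).  Cylinders pull back to
    dyadic intervals, so [phi] maps Lebesgue measure to [mu_N] by uniqueness of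
    measures; in particular the complement of [phi] of [0, 1) is [mu_N]-null. *)
Require Import Defs.
From HB Require Import structures.
From mathcomp Require Import all_boot all_order all_algebra all_fingroup.
From mathcomp Require Import all_classical all_reals all_analysis.
From mathcomp Require Import ring lra.
Import Order.TTheory GRing.Theory Num.Theory.
Local Open Scope classical_set_scope.
Local Open Scope ring_scope.

(** * Indices of dyadic intervals *)

Section DyadicIndex.
Local Set Implicit Arguments. Local Unset Strict Implicit.
Variable R : realType.
Implicit Types (m n : nat) (x y : R).

(** For $x\in[0,1)$ this is the integer written by the first $m$ binary digits of $x$. *)
Definition dyadic m x : nat := Num.truncn (2 ^+ m * x).

Lemma dyadic_itv m x : 0 <= x ->
  (dyadic m x)%:R <= 2 ^+ m * x < (dyadic m x)%:R + 1.
Proof. by move=> x0; rewrite natr1; apply: truncn_itv; rewrite mulr_ge0// exprn_ge0. Qed.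

Lemma dyadic_def m x (k : nat) :
  k%:R <= 2 ^+ m * x < k%:R + 1 -> dyadic m x = k.
Proof. by rewrite natr1; exact: truncn_def. Qed.

Lemma dyadicS m x : dyadic m.+1 x = dyadic m (2 * x).
Proof. by rewrite /dyadic exprSr mulrA. Qed.

(** Halving an index forgets its last binary digit, since each dyadic interval splits in two at the
    next level. *)
Lemma dyadic_half m x : 0 <= x -> (dyadic m.+1 x)./2 = dyadic m x.
Proof.
move=> x0; apply/esym/dyadic_def; have := dyadic_itv m.+1 x0.
rewrite exprS -mulrA; set d := dyadic _ _; set z := _ * x.
have -> : d%:R = 2 * (d./2)%:R + (odd d)%:R :> R.
  by rewrite -{1}(odd_double_half d) addnC natrD -mul2n natrM.
by case: (odd d); rewrite /= => /andP[h h']; apply/andP; split; lra.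
Qed.

Lemma dyadic_rcons m x : 0 <= x ->
  dyadic m.+1 x = (odd (dyadic m.+1 x) + (dyadic m x).*2)%N.
Proof. by move=> x0; rewrite -(dyadic_half m x0) odd_double_half. Qed.

Lemma eq_dyadic_le {n m x y} : 0 <= x -> 0 <= y -> (n <= m)%N ->
  dyadic m x = dyadic m y -> dyadic n x = dyadic n y.
Proof.
move=> x0 y0 /subnK <-; elim: (m - n)%N => [//|i IHi] e; apply: IHi.
by rewrite -(dyadic_half _ x0) -(dyadic_half _ y0) -addSn e.
Qed.

Lemma dyadic_lt m x : 0 <= x < 1 -> (dyadic m x < 2 ^ m)%N.
Proof.
move=> /andP[x0 x1]; rewrite -(ltr_nat R) natrX.
have /andP[h _] := dyadic_itv m x0.
apply: le_lt_trans h _; rewrite -[ltRHS]mulr1 ltr_pM2l// exprn_gt0//.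
Qed.

(** Translation by $(p-r)/2^m$ shifts the index by $p-r$. Keeping [p] and [r] on opposite sides
    avoids truncated subtraction in [nat]. *)
Lemma dyadicD m x y (p r : nat) : 0 <= x -> 2 ^+ m * y + r%:R = 2 ^+ m * x + p%:R ->
  (r <= dyadic m x + p)%N -> (dyadic m y + r = dyadic m x + p)%N.
Proof.
move=> x0 e le_r; apply/eqP; rewrite -[eqbRHS](subnK le_r) eqn_add2r; apply/eqP.
apply: dyadic_def; rewrite natrB// natrD.
by have /andP[h h'] := dyadic_itv m x0; apply/andP; split; lra.
Qed.

Lemma pow2_arch x : 0 < x -> exists m, 1 < 2 ^+ m * x.
Proof.
move=> x0; exists (Num.bound x^-1).
rewrite -ltr_pdivrMr// div1r; have := archi_boundP (ltW (eqbRL (invr_gt0 x) x0)).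
move=> /lt_trans; apply; rewrite -natrX ltr_nat; exact: ltn_expl.
Qed.

Lemma dyadic_inj k x y : 0 <= x -> 0 <= y ->
  (forall m, (k <= m)%N -> dyadic m x = dyadic m y) -> x = y.
Proof.
wlog lexy : x y / x <= y => [W x0 y0 e|x0 y0 e].
  have [/W|/ltW/W W'] := leP x y; first exact.
  by apply/esym/W' => // m km; rewrite e.
apply/eqP; rewrite eq_le lexy/= leNgt; apply/negP; rewrite -subr_gt0 => /pow2_arch[m].
(* At level $\max(k,m)$ the scaled distance exceeds 1, yet both points lie in one interval of scaled
   length 1. *)
have /andP[a _] := dyadic_itv (maxn k m) x0.
have /andP[_ b] := dyadic_itv (maxn k m) y0.
have ee : 2 ^+ m * (y - x) <= 2 ^+ (maxn k m) * (y - x) :> R.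
  by rewrite ler_wpM2r ?subr_ge0// -!natrX ler_nat leq_exp2l// leq_maxr.
move: a b ee; rewrite (e _ (leq_maxl _ _)) mulrBr; lra.
Qed.

End DyadicIndex.

(** * The action of $\mathfrak{a}$, $R_\pi$ and $F_\pi$ on dyadic indices *)

Section Odometer.
Local Set Implicit Arguments. Local Unset Strict Implicit.
Variable R : realType.
Implicit Types (m n : nat) (x y : R).

Lemma vNK_indexP x : 0 <= x < 1 ->
  (1 <= vNK_index x)%N /\
    1 - (2 : R) ^- (vNK_index x).-1 <= x /\ x < 1 - (2 : R) ^- vNK_index x.
Proof.
move=> /andP[x0 x1]; have [m hm] := pow2_arch (eqbRL (subr_gt0 _ _) x1).
rewrite /vNK_index; case: xgetP => //= H; exfalso.
have exP : exists n, x < 1 - (2 : R) ^- n.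
  exists m; have : (2 : R) ^- m < 1 - x; last by lra.
  by rewrite -div1r ltr_pdivrMr ?exprn_gt0// mulrC.
(* The least exponent works: it is positive because $x\ge 0$, and minimality gives the lower
   bound. *)
case: (ex_minnP exP) => -[|n] hn hmin; first by move: hn; rewrite expr0 invr1; lra.
apply: (H n.+1); split => //; split => //=; rewrite leNgt.
by apply/negP => /hmin; rewrite ltnn.
Qed.

Lemma vNK_index_eq x n : (1 <= n)%N -> 1 - (2 : R) ^- n.-1 <= x ->
  x < 1 - (2 : R) ^- n -> vNK_index x = n.
Proof.
move=> n1 xn xn'; rewrite /vNK_index; apply: xget_unique => // k [k1 [xk xk']].
have aux i j : (1 <= i)%N -> (1 <= j)%N -> 1 - (2 : R) ^- i.-1 <= x ->
    x < 1 - (2 : R) ^- j -> (i <= j)%N.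
  move=> i1 j1 hi hj; rewrite leqNgt; apply/negP => lt_ji.
  have : (2 : R) ^- i.-1 <= 2 ^- j; last by move: hi hj; lra.
  by rewrite lef_pV2 ?posrE ?exprn_gt0// -!natrX ler_nat leq_exp2l// -ltnS prednK.
by apply/eqP; rewrite eqn_leq (aux k n k1 n1 xk xn') (aux n k n1 k1 xn xk').
Qed.

Lemma vNK_lo x : 0 <= x -> 2 * x < 1 -> vNK x = x + 1 / 2.
Proof.
move=> x0 x1; rewrite /vNK (@vNK_index_eq x 1)//=; first by rewrite expr1; lra.
- by rewrite expr0 invr1; lra.
- by rewrite expr1; lra.
Qed.

(** The map $x\mapsto 2x-1$ lowers [vNK_index] by one, carrying each defining interval in $[1/2,1)$
    onto the previous one. *)
Lemma vNK_hi x : 1 <= 2 * x -> x < 1 -> vNK x = vNK (2 * x - 1) / 2.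
Proof.
move=> x0 x1; have /vNK_indexP : 0 <= 2 * x - 1 < 1 by lra.
rewrite /vNK; case: (vNK_index (2 * x - 1)) => [[]//|n] [_ [/= h1 h2]].
have e k : (2 : R) ^- k.+1 = 2 ^- k / 2 by rewrite exprSr invfM mulrC.
rewrite (@vNK_index_eq x n.+2)//= ?e; move: h1 h2; rewrite ?e; lra.
Qed.

Lemma vNK_range x : 0 <= x < 1 -> 0 <= vNK x < 1.
Proof.
move=> /vNK_indexP; rewrite /vNK; case: (vNK_index x) => [[]//|n] [_ [/=]].
have -> : (2 : R) ^- n.+1 = 2 ^- n / 2 by rewrite exprSr invfM mulrC.
have : 0 < (2 : R) ^- n <= 1 by rewrite invr_gt0 exprn_gt0//= invf_le1
  ?exprn_gt0// exprn_ege1// ler1n.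
lra.
Qed.

(** Recursion [a(x) = x + 1/2] on [0, 1/2), [a(x) = a(2x - 1)/2] on [1/2, 1):
    addition of 1 with carry to the right on binary digits. *)
Lemma dyadic_vNK m x y : 0 <= x < 1 -> 0 <= y < 1 ->
  (dyadic m (vNK x) == dyadic m (vNK y)) = (dyadic m x == dyadic m y).
Proof.
elim: m x y => [|m IHm] x y xI yI.
  have d0 z : 0 <= z < 1 -> dyadic 0 z = 0%N.
    by move=> /(dyadic_lt 0); rewrite expn0 ltnS leqn0 => /eqP.
  by rewrite !d0// vNK_range.
have lo (z : R) : 0 <= z -> 2 * z < 1 ->
    (dyadic m.+1 (vNK z) = dyadic m.+1 z + 2 ^ m)%N /\ (dyadic m.+1 z < 2 ^ m)%N.
  move=> z0 z1; split; last by rewrite dyadicS dyadic_lt//; lra.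
  rewrite vNK_lo//; have := @dyadicD R m.+1 z (z + 1 / 2) (2 ^ m) 0 z0.
  by rewrite addn0 => -> //; rewrite natrX exprS addr0; field.
have hi (z : R) : 1 <= 2 * z -> z < 1 ->
    (dyadic m.+1 (vNK z) = dyadic m (vNK (2 * z - 1)))%N /\
    (dyadic m.+1 z = dyadic m (2 * z - 1) + 2 ^ m)%N.
  move=> z0 z1; split; first by rewrite vNK_hi// dyadicS mulrC divfK.
  have := @dyadicD R m (2 * z - 1) (2 * z) (2 ^ m) 0; rewrite addn0 dyadicS => -> //.
    by lra.
  by rewrite natrX; ring.
(* The map exchanges the two halves of $[0,1)$, so in the mixed cases both sides are false: the
   first digits differ before and after. *)
have [hx|hx] := ltP (2 * x) 1; have [hy|hy] := ltP (2 * y) 1.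
- have [||-> _] := lo x; try lra; have [||-> _] := lo y; try lra.
  by rewrite eqn_add2r.
- have [||-> h] := lo x; try lra; have [||-> ->] := hi y; try lra.
  transitivity false; [|apply/esym]; apply/negbTE/eqP => e.
    have : (dyadic m (vNK (2 * y - 1)) < 2 ^ m)%N by apply/dyadic_lt/vNK_range; lra.
    by rewrite -e ltnNge leq_addl.
  by move: h; rewrite e ltnNge leq_addl.
- have [||-> h] := lo y; try lra; have [||-> ->] := hi x; try lra.
  transitivity false; [|apply/esym]; apply/negbTE/eqP => e.
    have : (dyadic m (vNK (2 * x - 1)) < 2 ^ m)%N by apply/dyadic_lt/vNK_range; lra.
    by rewrite e ltnNge leq_addl.
  by move: h; rewrite -e ltnNge leq_addl.
- have [||-> ->] := hi x; try lra; have [||-> ->] := hi y; try lra.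
  by rewrite IHm ?eqn_add2r//; lra.
Qed.

Variables (N : nat) (pi : {perm 'I_(2 ^ N)}).

Lemma iet_eq x (k : 'I_(2 ^ N)) : 0 <= x -> dyadic N x = k ->
  iet pi x = x + ((pi k)%:R - k%:R) / (2 ^+ N).
Proof.
move=> x0 xk; rewrite /iet (big_pred1 k) ?natrX// => i /=.
have q0 : 0 < (2 : R) ^+ N by rewrite exprn_gt0.
rewrite ler_pdivrMr ?ltr_pdivlMr ?natrX// ![x * _]mulrC -truncn_eq.
  by rewrite -/(dyadic N x) xk eq_sym.
by rewrite mulr_ge0// ltW.
Qed.

Lemma dyadic_iet i x (k : 'I_(2 ^ N)) : 0 <= x < 1 -> dyadic N x = k ->
  0 <= iet pi x < 1 /\
  (dyadic (N + i) (iet pi x) + k * 2 ^ i = dyadic (N + i) x + pi k * 2 ^ i)%N.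
Proof.
move=> /andP[x0 x1] xk; have q0 : 0 < (2 : R) ^+ N by rewrite exprn_gt0.
have e := @iet_eq x k x0 xk.
have e' : 2 ^+ N * iet pi x = 2 ^+ N * x + ((pi k)%:R - k%:R).
  by rewrite e; field; rewrite gt_eqF.
have /andP[dx dx'] := dyadic_itv N x0.
have ip : 0 <= (pi k)%:R :> R by [].
have pq : (pi k)%:R + 1 <= 2 ^+ N :> R by rewrite natr1 -natrX ler_nat.
move: dx dx'; rewrite xk => dx dx'; split.
  apply/andP; split; first by rewrite -(pmulr_rge0 _ q0) e'; lra.
  by rewrite -(ltr_pM2l q0) e'; lra.
apply: dyadicD => //.
  by rewrite exprD mulrAC e' !natrM natrX; ring.
(* The shifted index stays nonnegative, as [k] consists of the leading digits of the finer index. *)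
apply: leq_trans (leq_addr _ _); rewrite -(ler_nat R).
have /andP[_] := dyadic_itv (N + i) x0.
rewrite exprD mulrAC natrM natrX => h.
have : k%:R * 2 ^+ i <= 2 ^+ N * x * 2 ^+ i :> R by rewrite ler_wpM2r ?exprn_ge0.
move=> /le_lt_trans/(_ h); rewrite -natrX -natrM natr1 ltr_nat ler_nat.
exact.
Qed.

Lemma dyadic_ord x : 0 <= x < 1 -> exists k : 'I_(2 ^ N), dyadic N x = k.
Proof. by move=> /(dyadic_lt N) h; exists (Ordinal h). Qed.

Lemma rot_odometer_range x : 0 <= x < 1 -> 0 <= rot_odometer pi x < 1.
Proof.
move=> xI; have [k kE] := dyadic_ord xI.
by apply: vNK_range; have [] := dyadic_iet 0 xI kE.
Qed.

Lemma dyadic_rot_odometer i x y : 0 <= x < 1 -> 0 <= y < 1 ->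
  (dyadic (N + i) (rot_odometer pi x) == dyadic (N + i) (rot_odometer pi y)) =
  (dyadic (N + i) x == dyadic (N + i) y).
Proof.
move=> xI yI; have [k kE] := dyadic_ord xI; have [l lE] := dyadic_ord yI.
have [/andP[x0 _] /andP[y0 _]] := (xI, yI).
have [xJ xD] := dyadic_iet i xI kE; have [yJ yD] := dyadic_iet i yI lE.
have [/andP[x0' _] /andP[y0' _]] := (xJ, yJ).
rewrite dyadic_vNK//; apply/eqP/eqP => e.
  (* Passing to level $N$ gives $\pi(k)=\pi(l)$, hence $k=l$; both points were then translated by
     the same amount. *)
  have := eq_dyadic_le x0' y0' (leq_addr i N) e.
  have [_] := dyadic_iet 0 xI kE; have [_] := dyadic_iet 0 yI lE.
  rewrite !expn0 !muln1 !addn0 lE kE ![(k + _)%N]addnC ![(l + _)%N]addnC.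
  move=> /addIn-> /addIn->.
  move=> /val_inj/perm_inj kl; move: xD yD.
  by rewrite e kl => -> /addIn.
have kl : k = l.
  by apply: val_inj; rewrite /= -kE -lE; apply: eq_dyadic_le (leq_addr i N) e.
by apply/eqP; rewrite -(eqn_add2r (k * 2 ^ i)) xD {2}kl yD e kl.
Qed.

End Odometer.

(** * Binary expansions as boundary points *)

Section Expansion.
Local Set Implicit Arguments. Local Unset Strict Implicit.
Variables (R : realType) (N : nat).
Implicit Types (x y : R) (v : vertex N) (xi : boundary N).

(** Bit [i] is the binary digit of rank $N+i+1$, the parity of the index at that level. The default
    of [insubd] is not reached on $[0,1)$. *)
Definition expansion x : boundary N :=
  (insubd (Ordinal (boundary_default_proof N)) (dyadic N x),
   fun i => odd (dyadic (N + i).+1 x)).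

(** Horner evaluation: the index of the dyadic interval with address [(a, s)], whose left endpoint
    is [vpoint]. *)
Definition vindex (a : 'I_(2 ^ N)) (s : seq bool) : nat :=
  foldl (fun k (b : bool) => (b + k.*2)%N) a s.

Definition vlevel v : nat := if v is Some (_, s) then (size s).+1 else 0.

Definition vpoint v : R :=
  if v is Some (a, s) then (vindex a s)%:R / 2 ^+ (N + size s) else 0.

Lemma vindex_rcons a s b : vindex a (rcons s b) = (b + (vindex a s).*2)%N.
Proof. by rewrite /vindex foldl_rcons. Qed.

Lemma vindex_lt a s : (vindex a s < 2 ^ (N + size s))%N.
Proof.
elim/last_ind: s => [|s b IHs]; first by rewrite addn0 ltn_ord.
rewrite vindex_rcons size_rcons addnS expnS mul2n -ltn_half_double half_bit_double.
exact: IHs.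
Qed.

Lemma vpoint_itv v : 0 <= vpoint v < 1.
Proof.
case: v => [[a s]|] /=; last by rewrite lexx ltr01.
have p0 : 0 < (2 : R) ^+ (N + size s) by rewrite exprn_gt0.
rewrite divr_ge0 ?exprn_ge0//= ltr_pdivrMr// mul1r -natrX ltr_nat.
exact: vindex_lt.
Qed.

Lemma vlevel_prefix i xi : vlevel (bprefix i xi) = i.
Proof. by case: i => //= i; rewrite size_mkseq. Qed.

Lemma bprefixS i xi : bprefix i.+2 xi = Some (xi.1, rcons (mkseq xi.2 i) (xi.2 i)).
Proof. by rewrite /bprefix mkseqS. Qed.

Lemma boundary_eq xi eta : (forall i, bprefix i xi = bprefix i eta) -> xi = eta.
Proof.
move=> e; rewrite (surjective_pairing xi) (surjective_pairing eta).
congr (_, _); first by case: (e 1%N).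
by apply/funext => i; have := e i.+2; rewrite !bprefixS => -[_ /rcons_inj[_ ->]].
Qed.

Lemma bit_double_eq (b c : bool) (m n : nat) :
  (b + m.*2 == c + n.*2)%N = (b == c) && (m == n).
Proof.
apply/eqP/andP => [e|[/eqP-> /eqP->]//]; split.
  by move: (congr1 odd e); rewrite !oddD !odd_double !addbF !oddb => ->.
by move: (congr1 half e); rewrite !half_bit_double => ->.
Qed.

Lemma expansion_prefix x a s : 0 <= x < 1 ->
  bprefix (size s).+1 (expansion x) = Some (a, s) <->
  dyadic (N + size s) x = vindex a s.
Proof.
move=> /[dup] xI /andP[x0 _]; elim/last_ind: s => [|s b IHs].
  rewrite addn0 /vindex /=; have xN := dyadic_lt N xI; split => [[<-]|e].
    by rewrite val_insubd xN.
  by congr (Some (_, _)); apply/val_inj; rewrite val_insubd xN.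
rewrite size_rcons bprefixS vindex_rcons addnS dyadic_rcons//.
split => [[ea /rcons_inj[es eb]]|/eqP].
  apply/eqP; rewrite bit_double_eq -eb eqxx/=; apply/eqP/IHs.
  by rewrite /= -ea es.
rewrite bit_double_eq => /andP[/eqP <- /eqP/IHs/= [-> es]].
by rewrite es.
Qed.

Lemma eq_expansion_prefix i x y : 0 <= x < 1 -> 0 <= y < 1 ->
  bprefix i.+1 (expansion x) = bprefix i.+1 (expansion y) <->
  dyadic (N + i) x = dyadic (N + i) y.
Proof.
move=> xI yI; pose t := mkseq (expansion y).2 i.
have ti : size t = i by rewrite size_mkseq.
have := expansion_prefix (expansion y).1 t yI.
have := expansion_prefix (expansion y).1 t xI.
rewrite ti => hx [/(_ erefl) hy _]; rewrite hy; exact: hx.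
Qed.

(** Scaled to its level, a left endpoint is exactly its index. Every vertex thus lies on the path of
    a real number, so that tree questions reduce to dyadic indices. *)
Lemma vpointK v : bprefix (vlevel v) (expansion (vpoint v)) = v.
Proof.
case: v => [[a s]|//]; apply/expansion_prefix; first exact: vpoint_itv.
apply: dyadic_def; rewrite /vpoint mulrC divfK ?gt_eqF ?exprn_gt0//.
by rewrite lexx ltrDl ltr01.
Qed.

End Expansion.
Arguments expansion {R} N x.
Arguments vpoint R {N} v.

(** * Tree automorphism of a map respecting dyadic indices *)

Section TreeMap.
Local Set Implicit Arguments. Local Unset Strict Implicit.
Variables (R : realType) (N : nat) (F : R -> R).
Hypothesis F_itv : forall x, 0 <= x < 1 -> 0 <= F x < 1.
Hypothesis dyadicF : forall i x y, 0 <= x < 1 -> 0 <= y < 1 ->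
  (dyadic (N + i) (F x) == dyadic (N + i) (F y)) =
  (dyadic (N + i) x == dyadic (N + i) y).
Implicit Types (x y : R) (u v w : vertex N) (xi : boundary N).

(** The image of a vertex is read off from the left endpoint of its dyadic interval. *)
Definition vertex_map v : vertex N :=
  bprefix (vlevel v) (expansion N (F (vpoint R v))).

(** Each letter is read from the shortest prefix containing it, so the map is also defined on
    sequences that are not expansions. *)
Definition boundary_map xi : boundary N :=
  ((expansion N (F (vpoint R (bprefix 1 xi)))).1,
   fun i => (expansion N (F (vpoint R (bprefix i.+2 xi)))).2 i).

Lemma eq_expansion_map i x y : 0 <= x < 1 -> 0 <= y < 1 ->
  bprefix i (expansion N (F x)) = bprefix i (expansion N (F y)) <->
  bprefix i (expansion N x) = bprefix i (expansion N y).
Proof.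
move=> xI yI; case: i => // i; rewrite !eq_expansion_prefix ?F_itv//.
by split=> /eqP; [rewrite dyadicF// => /eqP|rewrite -dyadicF// => /eqP].
Qed.

Lemma vlevel_map v : vlevel (vertex_map v) = vlevel v.
Proof. by rewrite /vertex_map vlevel_prefix. Qed.

(** Any point of the dyadic interval may replace its left endpoint, by [dyadicF]. *)
Lemma vertex_map_prefix i x : 0 <= x < 1 ->
  vertex_map (bprefix i (expansion N x)) = bprefix i (expansion N (F x)).
Proof.
move=> xI; rewrite /vertex_map vlevel_prefix; apply/eq_expansion_map => //.
  exact: vpoint_itv.
by rewrite -{1}(vlevel_prefix i (expansion N x)) vpointK.
Qed.

Lemma vertex_map_inj : injective vertex_map.
Proof.
move=> u v e; have elev : vlevel u = vlevel v by rewrite -vlevel_map e vlevel_map.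
rewrite -(vpointK R u) -(vpointK R v) elev.
apply/eq_expansion_map; [exact: vpoint_itv..|].
by rewrite -{1}elev.
Qed.

Lemma vertex_map_surj w : exists v, vertex_map v = w.
Proof.
case: w => [[a s]|]; last by exists None.
(* [T] is the finite level of the target vertex; levels are preserved, so injectivity there yields
   surjectivity. *)
pose T := ('I_(2 ^ N) * (size s).-tuple bool)%type.
pose emb (t : T) : vertex N := Some (t.1, val t.2).
have emb_inj : injective emb by move=> [b t] [c r] [-> /val_inj ->].
have proj v : vlevel v = (size s).+1 -> exists t, emb t = v.
  by case: v => [[b r]|//] [/eqP rs]; exists (b, Tuple rs).
have lift t : exists t', emb t' = vertex_map (emb t).
  by apply: proj; rewrite vlevel_map /= size_tuple.
have [h hE] := choice lift.
have h_inj : injective h.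
  by move=> t r e; apply/emb_inj/vertex_map_inj; rewrite -!hE e.
have [h' _ h'K] := injF_bij h_inj.
have [t tE] := proj (Some (a, s)) erefl.
by exists (emb (h' t)); rewrite -hE h'K.
Qed.

Lemma vertex_map_bij : bijective vertex_map.
Proof.
have [f fK] := choice vertex_map_surj.
by exists f => // v; apply: vertex_map_inj; rewrite fK.
Qed.

Lemma vchild_prefix i xi : vchild (bprefix i xi) (bprefix i.+1 xi).
Proof.
case: i => // i; rewrite bprefixS /= size_rcons !size_mkseq !eqxx /=.
by rewrite -cats1 take_size_cat ?size_mkseq.
Qed.

Lemma vchild_expansion u v : vchild u v -> exists i x,
  [/\ 0 <= x < 1, u = bprefix i (expansion N x) & v = bprefix i.+1 (expansion N x)].
Proof.
case: v => [[b t]|]; last by case: u => [[]|].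
move=> uv; exists (size t), (vpoint R (Some (b, t))).
have e := vpointK R (Some (b, t)); split=> //; first exact: vpoint_itv.
move: e uv; move: (expansion N _) => xi; case: u => [[a s]|]; last first.
  by move=> _ /= /eqP ->.
rewrite [vlevel _]/= => e /=; move=> /andP[/andP[/eqP -> /eqP st] /eqP ts].
move: e; rewrite st bprefixS => -[<- et].
by rewrite -{1}ts -et -cats1 take_size_cat ?size_mkseq.
Qed.

Lemma vchild_vlevel u v : vchild u v -> vlevel v = (vlevel u).+1.
Proof. by move=> /vchild_expansion[i [x [_ -> ->]]]; rewrite !vlevel_prefix. Qed.

Lemma vchild_inj u v w : vchild u w -> vchild v w -> u = v.
Proof.
move=> uw vw; have [e] : (vlevel u).+1 = (vlevel v).+1.
  by rewrite -(vchild_vlevel uw) -(vchild_vlevel vw).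
case: u v w uw vw e => [[a s]|] [[b t]|] [[c r]|]//=.
by move=> /andP[/andP[/eqP -> _] /eqP rs] /andP[/andP[/eqP -> _] /eqP rt] [e];
  rewrite -rs -rt e.
Qed.

Lemma vchild_map u v : vchild (vertex_map u) (vertex_map v) = vchild u v.
Proof.
have mono u' v' : vchild u' v' -> vchild (vertex_map u') (vertex_map v').
  move=> /vchild_expansion[i [x [xI -> ->]]].
  by rewrite !vertex_map_prefix// vchild_prefix.
apply/idP/idP => [uv|/mono//].
have lv := vchild_vlevel uv; rewrite !vlevel_map in lv.
have vx := vpointK R v; rewrite lv in vx.
have xI := vpoint_itv R v; set xi := expansion _ _ in vx.
(* The image of the parent of [v] is a parent of the image of [v]; uniqueness of parents and
   injectivity identify that parent with [u]. *)
have pv : vchild (bprefix (vlevel u) xi) v by rewrite -[in X in vchild _ X]vx vchild_prefix.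
by rewrite -(vertex_map_inj (vchild_inj (mono _ _ pv) uv)).
Qed.

Lemma tree_aut_vertex_map : tree_aut vertex_map.
Proof.
by split=> [|u v]; [exact: vertex_map_bij|rewrite /tadj !vchild_map].
Qed.

Lemma induced_by_boundary_map : induced_by vertex_map boundary_map.
Proof.
move=> xi [//|i]; rewrite /vertex_map vlevel_prefix /boundary_map.
set x := vpoint R (bprefix i.+1 xi); have xI : 0 <= x < 1 := vpoint_itv R _.
(* The real points chosen for different prefixes give coherent letters: they share the shorter
   prefix, hence so do their images. *)
have same j : (j <= i)%N ->
    bprefix j.+1 (expansion N (F (vpoint R (bprefix j.+1 xi)))) =
    bprefix j.+1 (expansion N (F x)).
  move=> ji; apply/eq_expansion_map; [exact: vpoint_itv|exact: xI|].
  have := vpointK R (bprefix j.+1 xi); have := vpointK R (bprefix i.+1 xi).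
  rewrite !vlevel_prefix -/x => -[e1 e2 ->]; rewrite /= e1; congr (Some (_, _)).
  apply: (@eq_from_nth _ false); rewrite !size_mkseq// => k kj.
  have ki := leq_trans kj ji; rewrite !nth_mkseq//.
  by have := congr1 (nth false ^~ k) e2; rewrite !nth_mkseq.
rewrite /=; congr (Some (_, _)).
  by have [] := same 0%N (leq0n _).
apply: (@eq_from_nth _ false); rewrite !size_mkseq// => k ki.
rewrite !nth_mkseq//; have := same k.+1 ki.
by rewrite !(bprefixS k (expansion _ _)) => -[_ /rcons_inj[_ ->]].
Qed.

Lemma boundary_map_expansion x : 0 <= x < 1 ->
  boundary_map (expansion N x) = expansion N (F x).
Proof.
move=> xI; apply: boundary_eq => i.
by rewrite induced_by_boundary_map vertex_map_prefix.
Qed.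

End TreeMap.

(** * Measurable isomorphism of $[0,1)$ with the boundary *)

Section Isomorphism.
Local Set Implicit Arguments. Local Unset Strict Implicit.
Variables (R : realType) (N : nat).
Implicit Types (x y : R) (v : vertex N) (xi : boundary N).

Definition unit_part x : R := if x \in `[0, 1[ then x else 0.

Definition coding : measurableTypeR R -> bmeas N :=
  fun x => expansion N (unit_part x).

(** The left endpoints along a path increase to the coded point; taking their supremum gives
    measurability from that of each prefix. *)
Definition decoding : bmeas N -> measurableTypeR R :=
  fun xi => sups (fun n => vpoint R (bprefix n.+1 xi)) 0.

(** The fixed points of [coding \o decoding] are exactly the sequences that are
    not eventually 1; in this form measurability needs no computation. *)
Definition coded : set (bmeas N) := [set xi | coding (decoding xi) = xi].

Lemma unit_part_itv x : 0 <= unit_part x < 1.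
Proof. by rewrite /unit_part; case: ifP; rewrite ?in_itv//= lexx ltr01. Qed.

Lemma unit_part_id x : 0 <= x < 1 -> unit_part x = x.
Proof. by move=> xI; rewrite /unit_part in_itv/= xI. Qed.

Lemma vpoint_expansion i x : 0 <= x < 1 ->
  vpoint R (bprefix i.+1 (expansion N x)) = (dyadic (N + i) x)%:R / 2 ^+ (N + i).
Proof.
move=> xI; have [] := expansion_prefix (expansion N x).1 (mkseq (expansion N x).2 i) xI.
by rewrite size_mkseq => /(_ erefl) e _; rewrite e /vpoint /bprefix size_mkseq.
Qed.

Lemma decoding_ub xi : has_ubound (range (fun n => vpoint R (bprefix n.+1 xi))).
Proof.
by exists 1 => _ [n _ <-]; have /andP[_ /ltW] := vpoint_itv R (bprefix n.+1 xi).
Qed.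

Lemma decoding_expansion x : 0 <= x < 1 -> decoding (expansion N x) = x.
Proof.
move=> /[dup] xI /andP[x0 _].
set y := decoding _.
have le_x i : vpoint R (bprefix i.+1 (expansion N x)) <= x.
  rewrite vpoint_expansion// ler_pdivrMr ?exprn_gt0// mulrC.
  by have /andP[] := dyadic_itv (N + i) x0.
have le_y i : vpoint R (bprefix i.+1 (expansion N x)) <= y.
  apply: ub_le_sup; last by exists i.
  by have [z zub] := decoding_ub (expansion N x); exists z => _ [n _ <-]; apply: zub; exists n.
have y_le : y <= x.
  apply: sup_le_ub; first by exists (vpoint R (bprefix 1 (expansion N x))), 0%N.
  by move=> _ [n _ <-]; exact: le_x.
have y0 : 0 <= y by apply: le_trans (le_y 0%N);
  have /andP[] := vpoint_itv R (bprefix 1 (expansion N x)).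
(* The supremum lies between each left endpoint and [x], hence in every dyadic interval of [x] from
   level $N$ on. *)
apply: (@dyadic_inj _ N) => // m /subnKC <-; apply: dyadic_def.
have /andP[_ h] := dyadic_itv (N + (m - N)) x0.
have := le_y (m - N)%N; rewrite vpoint_expansion// ler_pdivrMr ?exprn_gt0// mulrC => ->/=.
by apply: le_lt_trans h; rewrite ler_pM2l ?exprn_gt0.
Qed.

Lemma coding_expansion x : 0 <= x < 1 -> coding x = expansion N x.
Proof. by move=> xI; rewrite /coding unit_part_id. Qed.

Lemma codingK x : 0 <= x < 1 -> decoding (coding x) = x.
Proof. by move=> xI; rewrite coding_expansion// decoding_expansion. Qed.

Lemma coded_coding x : coded (coding x).
Proof.
by rewrite /coded /= {2}/coding decoding_expansion ?unit_part_itv//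
  coding_expansion// unit_part_itv.
Qed.

Lemma decoding_itv xi : coded xi -> 0 <= decoding xi < 1.
Proof.
by move=> <-; rewrite /coding decoding_expansion ?unit_part_itv.
Qed.

Lemma expansion_cylinder x a s : 0 <= x < 1 ->
  cylinder a s (expansion N x) <->
  x \in `[(vindex a s)%:R / 2 ^+ (N + size s), ((vindex a s)%:R + 1) / 2 ^+ (N + size s)[.
Proof.
move=> /[dup] xI /andP[x0 _]; rewrite /cylinder/= expansion_prefix//.
rewrite in_itv/= ler_pdivrMr ?ltr_pdivlMr ?exprn_gt0// ![x * _]mulrC; split.
  by move=> <-; exact: dyadic_itv.
exact: dyadic_def.
Qed.

Lemma countable_vertex : countable [set: vertex N].
Proof. exact: (@countableP (option ('I_(2 ^ N) * seq bool)%type)). Qed.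

Lemma measurable_cylinder a s : measurable (cylinder a s : set (bmeas N)).
Proof. by apply: sub_sigma_algebra; exists a, s. Qed.

Lemma measurable_prefix n v : measurable [set xi : bmeas N | bprefix n xi = v].
Proof.
case: n => [|n].
  have [->|vN] := eqVneq v None.
    by rewrite (_ : mkset _ = setT)//; apply/seteqP.
  rewrite (_ : mkset _ = set0)//; apply/seteqP; split => // xi /= e.
  by rewrite -e eqxx in vN.
case: v => [[a s]|]; last by rewrite (_ : mkset _ = set0)//; apply/seteqP; split.
have [<-|sn] := eqVneq (size s) n; first exact: measurable_cylinder.
rewrite (_ : mkset _ = set0)//; apply/seteqP; split => // xi /= [_ e].
by rewrite -e size_mkseq eqxx in sn.
Qed.

Lemma measurable_fun_prefix n (f : vertex N -> R) :
  measurable_fun [set: bmeas N] (fun xi => f (bprefix n xi) : measurableTypeR R).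
Proof.
move=> _ Y _; rewrite setTI.
rewrite (_ : _ @^-1` _ =
    \bigcup_v [set xi : bmeas N | bprefix n xi = v /\ Y (f v)]).
  apply: countable_bigcupT_measurable; first exact: countable_vertex.
  move=> v; have [Yv|nYv] := pselect (Y (f v)).
    rewrite (_ : mkset _ = [set xi | bprefix n xi = v]); first exact: measurable_prefix.
    by apply/seteqP; split => // xi [].
  by rewrite (_ : mkset _ = set0)//; apply/seteqP; split => // xi [].
by apply/seteqP; split => [xi Yxi|xi [v _ [<-]]//]; exists (bprefix n xi).
Qed.

Lemma measurable_decoding : measurable_fun [set: bmeas N] decoding.
Proof.
apply: measurable_realfun.measurable_fun_sups => [xi _|n]; first exact: decoding_ub.
exact: (measurable_fun_prefix n.+1 (vpoint R)).
Qed.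

Lemma measurable_unit_part :
  measurable_fun [set: measurableTypeR R] (unit_part : measurableTypeR R -> measurableTypeR R).
Proof.
apply: measurable_fun_ifT => //.
apply: (measurable_fun_bool true) => //; rewrite setTI.
by rewrite (_ : _ @^-1` _ = [set` `[0, 1[]).
Qed.

(** Cylinders generate the sigma-algebra, and they pull back along [expansion] to half-open
    intervals. *)
Lemma measurable_coding : measurable_fun [set: measurableTypeR R] coding.
Proof.
have := @measurability _ _ (measurableTypeR R) (bmeas N)
  [set: measurableTypeR R] coding (@cylinders N) erefl.
apply => _ [_ [a [s ->]] <-].
rewrite setTI (_ : _ @^-1` _ = unit_part @^-1` 
  [set` `[(vindex a s)%:R / 2 ^+ (N + size s), ((vindex a s)%:R + 1) / 2 ^+ (N + size s)[]).
  by rewrite -[X in measurable X]setTI; apply: measurable_unit_part => //.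
by apply/seteqP; split => x; rewrite /preimage/= => /expansion_cylinder;
  apply; exact: unit_part_itv.
Qed.

Lemma measurable_coded : measurable coded.
Proof.
(* Equality of two sequences is tested on prefixes, which take countably many values. *)
rewrite (_ : coded = \bigcap_n \bigcup_v
   ([set xi | bprefix n xi = v] `&` (coding \o decoding) @^-1` [set xi | bprefix n xi = v])).
  apply: bigcapT_measurable => n; apply: countable_bigcupT_measurable;
    first exact: countable_vertex.
  move=> v.
  apply: measurableI; first exact: measurable_prefix.
  rewrite -[X in measurable X]setTI.
  by apply: (measurableT_comp measurable_coding measurable_decoding) => //;
    exact: measurable_prefix.
apply/seteqP; split => [xi cxi n _|xi h].
  by exists (bprefix n xi) => //; split=> //=; rewrite cxi.
by apply: boundary_eq => i; have [v _ [/= -> ->]] := h i I.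
Qed.

Lemma lebesgue_cylinder a s :
  @lebesgue_measure R (`[0, 1[ `&` coding @^-1` cylinder a s) = ((2 : R) ^- (N + size s))%:E.
Proof.
set m := (N + size s)%N; have p0 : 0 < (2 : R) ^+ m by rewrite exprn_gt0.
rewrite (_ : _ `&` _ = [set` `[(vindex a s)%:R / 2 ^+ m, ((vindex a s)%:R + 1) / 2 ^+ m[]).
  rewrite lebesgue_measure_itv/= lte_fin ltr_pM2r ?invr_gt0// ltrDl ltr01.
  by rewrite -EFinB mulrDl addrAC subrr add0r div1r.
apply/seteqP; split => x.
  by move=> [xI]; rewrite /= in xI; rewrite /preimage/= coding_expansion//;
    move=> /expansion_cylinder; apply.
move=> xJ; have xI : 0 <= x < 1.
  move: xJ; rewrite /= in_itv/= => /andP[h h']; apply/andP; split.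
    by apply: le_trans h; rewrite divr_ge0// ltW.
  apply: lt_le_trans h' _; rewrite ler_pdivrMr// mul1r natr1 -natrX ler_nat.
  exact: vindex_lt.
by split; [rewrite /= in_itv|rewrite /preimage/= coding_expansion//; apply/expansion_cylinder].
Qed.

Lemma subset_cylinder xi a s b t : (size s <= size t)%N ->
  cylinder a s xi -> cylinder b t xi -> cylinder b t `<=` cylinder a s.
Proof.
move=> st [<- es] [<- et] eta [<- et']; rewrite /cylinder/=; congr (Some (_, _)).
rewrite -{2}es; apply: (@eq_from_nth _ false); rewrite !size_mkseq// => k ks.
have := congr1 (nth false ^~ k) (etrans et' (esym et)).
by rewrite !nth_mkseq// (leq_trans ks).
Qed.

(** Two cylinders that meet are nested; the empty set is adjoined for those that do not. *)
Lemma setI_closed_cylinders : setI_closed (@cylinders N `|` [set set0]).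
Proof.
move=> A B [|->]; last by rewrite set0I; right.
move=> [a [s ->]] [|->]; last by rewrite setI0; right.
move=> [b [t ->]]; have [->|/set0P[xi [xa xb]]] := eqVneq (cylinder a s `&` cylinder b t) set0.
  by right.
left; have [st|/ltnW ts] := leqP (size s) (size t).
  by exists b, t; apply/setIidr/(subset_cylinder st xa xb).
by exists a, s; apply/setIidl/(subset_cylinder ts xb xa).
Qed.

Variable mu : {measure set (bmeas N) -> \bar R}.
Hypothesis mu_bernoulli : is_bernoulli_mu mu.

Lemma coding_preserves (B : set (bmeas N)) : measurable B ->
  @lebesgue_measure R (`[0, 1[ `&` coding @^-1` B) = mu B.
Proof.
move=> mB; have mI : measurable (`[0, 1[%classic : set (measurableTypeR R)) by [].
rewrite setIC.
pose nu := [the measure _ _ of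
  pushforward [the measure _ _ of mrestr (@lebesgue_measure R) mI] coding].
rewrite -[LHS]/(nu measurable_coding B).
pose q0 := Ordinal (boundary_default_proof N).
(* The exhausting family consists of the level-one cylinders, indexed by [nat] with repetitions
   through [insubd]. *)
apply: (@measure_unique _ R (bmeas N) (@cylinders N `|` [set set0])
  (fun i => cylinder (insubd q0 i) [::]) _ _ _ _ (nu measurable_coding) mu) => //.
- apply/seteqP; split; first exact: sub_sigma_algebra2 (@subsetUl _ _ _).
  apply: smallest_sub; first exact: sigma_algebra_measurable.
  by move=> C [[a [s ->]]|->] //; exact: measurable_cylinder.
- exact: setI_closed_cylinders.
- by move=> i; left; exists (insubd q0 i), [::].
- apply/seteqP; split => // xi _; exists (val xi.1) => //.
  by rewrite /cylinder/= valKd; case: xi.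
- move=> C [[a [s ->]]|->]; last by rewrite !measure0.
  rewrite mu_bernoulli /nu/= /pushforward /mrestr setIC; exact: lebesgue_cylinder.
- move=> i; rewrite /nu/= /pushforward /mrestr setIC lebesgue_cylinder; exact: ltry.
Qed.

End Isomorphism.

Theorem theorem1p5 (R : realType) (N : nat) (pi : {perm 'I_(2 ^ N)})
    (mu : {measure set (bmeas N) -> \bar R}) :
  (1 <= N)%N -> is_bernoulli_mu mu ->
  exists (g : vertex N -> vertex N) (Ft : bmeas N -> bmeas N),
    tree_aut g /\ induced_by g Ft /\
    exists (phi : measurableTypeR R -> bmeas N) (psi : bmeas N -> measurableTypeR R)
           (M1 : set (measurableTypeR R)) (M2 : set (bmeas N)),
      [/\ (* full-measure invariant subsets *)
          measurable M1, M1 `<=` `[0, 1[,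
          (@lebesgue_measure R) (`[0, 1[ `\` M1) = 0%E,
          rot_odometer pi @` M1 `<=` M1 &
          [/\ measurable M2, mu (~` M2) = 0%E, Ft @` M2 `<=` M2 &
          (* phi : M1 -> M2 bijective with inverse psi, both measurable *)
          [/\ phi @` M1 `<=` M2, psi @` M2 `<=` M1,
              {in M1, cancel phi psi}, {in M2, cancel psi phi} &
          [/\ measurable_fun M1 phi, measurable_fun M2 psi,
              (* measure preserving *)
              (forall B : set (bmeas N), measurable B ->
                 (@lebesgue_measure R) (M1 `&` phi @^-1` B) = mu B) &
              (* conjugacy *)
              {in M1, forall x, Ft (phi x) = phi (rot_odometer pi x)}]]]].
Proof.
move=> _ mu_bernoulli; have FI := @rot_odometer_range R N pi.
have inI (x : R) : x \in (`[0, 1[%classic : set R) -> 0 <= x < 1.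
  by rewrite inE /= in_itv.
exists (vertex_map (@rot_odometer R N pi)), (boundary_map (@rot_odometer R N pi)).
split; first exact: (tree_aut_vertex_map FI (@dyadic_rot_odometer R N pi)).
have ind := induced_by_boundary_map FI (@dyadic_rot_odometer R N pi).
have conj := boundary_map_expansion FI (@dyadic_rot_odometer R N pi).
split; first exact: ind.
exists (@coding R N), (@decoding R N), `[0, 1[%classic, (@coded R N); split.
- by [].
- by [].
- by rewrite setDv measure0.
- by move=> _ [x /= + <-]; rewrite !in_itv; exact: FI.
split.
- exact: measurable_coded.
(* Every value of [coding] is coded, so the complement of [coded] has empty preimage. *)
- rewrite -coding_preserves//; last by apply: measurableC; exact: measurable_coded.
  rewrite (_ : _ `&` _ = set0) ?measure0//; apply/seteqP; split => // x [_].
  by apply; exact: coded_coding.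
(* A coded sequence is the expansion of a point of $[0,1)$, where the conjugacy sends it to another
   expansion. *)
- move=> _ [xi cxi <-]; have xI := decoding_itv cxi.
  rewrite -cxi coding_expansion// conj// -coding_expansion ?FI//.
  exact: coded_coding.
split.
- by move=> _ [x _ <-]; exact: coded_coding.
- by move=> _ [xi cxi <-]; rewrite /= in_itv; exact: decoding_itv.
- by move=> x /inI xI; exact: codingK.
- by move=> xi; rewrite inE.
split.
- by apply: measurable_funTS; exact: measurable_coding.
- by apply: measurable_funTS; exact: measurable_decoding.
- exact: coding_preserves.
- by move=> x /inI xI; rewrite !coding_expansion ?FI// conj.
Qed.
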